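(* Let $S\subseteq\mathbb{R}^n$ be a star-shaped body with diameter $D$ and $\eta(S)>0$. Then for any measurable partition $(S_1,S_3,S_2)$ of $S$ (i.e. $S_1,S_2,S_3$ measurable, pairwise disjoint, with union $S$), \[ \mathrm{vol}(S_3)\ \ge\ \frac{\eta(S)}{4D}\, d(S_1,S_2)\,\min\{\mathrm{vol}(S_1),\mathrm{vol}(S_2)\}, \] where $d(S_1,S_2)=\inf\{\|x-y\|: x\in S_1,\ y\in S_2\}$.
   Context: A compact body is a compact set $S\subseteq\mathbb{R}^n$ with nonempty interior such that $S$ equals the closure of its interior. The kernel of $S$ is $K_S=\{x\in S:\ [x,y]\subseteq S \text{ for all } y\in S\}$, where $[x,y]$ is the closed line segment. $S$ is star-shaped if $K_S\neq\emptyset$; a star-shaped body is a compact body that is star-shaped. $\eta(S)=\mathrm{vol}(K_S)/\mathrm{vol}(S)$, with $\mathrm{vol}$ the $n$-dimensional Lebesgue measure. *)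

(* Defs.v *)
From HB Require Import structures.
From mathcomp Require Import all_boot all_order all_algebra.
From mathcomp Require Import all_classical all_reals all_analysis.
Set Implicit Arguments. Unset Strict Implicit. Unset Printing Implicit Defensive.
Import Order.TTheory GRing.Theory Num.Theory.
Import numFieldNormedType.Exports.
Local Open Scope classical_set_scope.
Local Open Scope ring_scope.

Section Defs.
Variables (R : realType) (n : nat).
Implicit Types (A : set 'rV[R]_n) (x y a b : 'rV[R]_n).

Definition enorm x : R := Num.sqrt (\sum_(i < n) x ord0 i ^+ 2).

Definition box a b : set 'rV[R]_n :=
  [set x | forall i, a ord0 i <= x ord0 i <= b ord0 i].
Definition box_vol a b : R := \prod_(i < n) (b ord0 i - a ord0 i).

Definition leb_outer A : \bar R :=
  ereal_inf [set s : \bar R | exists (u v : nat -> 'rV[R]_n),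
    [/\ (forall k i, u k ord0 i <= v k ord0 i),
        A `<=` \bigcup_k box (u k) (v k) &
        s = (\sum_(0 <= k <oo) (box_vol (u k) (v k))%:E)%E]].

Definition leb_measurable A : Prop :=
  forall X, leb_outer X = (leb_outer (X `&` A) + leb_outer (X `&` ~` A))%E.

(* vol = Lebesgue measure (outer measure restricted to measurable sets) *)
Definition vol A : \bar R := leb_outer A.

Definition compact_body A : Prop :=
  [/\ compact A, A° !=set0 & A = closure A°].

Definition segment x y : set 'rV[R]_n :=
  [set (1 - t) *: x + t *: y | t in `[0, 1]%classic].

Definition kernel A : set 'rV[R]_n :=
  [set x | A x /\ forall y, A y -> segment x y `<=` A].

Definition star_shaped A : Prop := kernel A !=set0.

Definition star_shaped_body A : Prop := compact_body A /\ star_shaped A.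

(* eta(S) = vol(K_S)/vol(S) (both volumes finite for a compact body) *)
Definition star_ratio A : R := fine (vol (kernel A)) / fine (vol A).

Definition diam A : R :=
  sup [set r : R | exists x y, [/\ A x, A y & r = enorm (x - y)]].

(* distance between sets, +oo if one of them is empty *)
Definition set_dist A B : \bar R :=
  ereal_inf [set r : \bar R | exists x y, [/\ A x, B y & r = (enorm (x - y))%:E]].

End Defs.

(* Main.v *)
(** Match a set A inside S1 with a set B inside the part of the kernel lying in
    S2: after replacing both by finite unions of small grid boxes, the
    Hadwiger-Ohmann cutting procedure produces pairs (P, Q) of subboxes, with
    vol P : vol Q constant, such that for each fixed t the boxes
    (1 - t) P + t Q are pairwise separated; by AM-GM each has volume at least
    min (vol P, vol Q). A segment from A to B lies in S and spends at least the
    fraction d(S1, S2) / D of its time in S3, so averaging over t = j / M and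
    packing the moving boxes into a cover of S3 gives
      D vol S3 >= d(S1, S2) min (vol A, vol B).
    This is used for (S1, K inter S2) and (S2, K inter S1), where K is the
    kernel; since vol K <= vol (K inter S1) + vol (K inter S2) + vol S3, one of
    the resulting bounds, or d(S1, S2) <= D, suffices. *)
Require Import Defs.
From HB Require Import structures.
From mathcomp Require Import all_boot all_order all_algebra.
From mathcomp Require Import all_classical all_reals all_analysis.
From mathcomp Require Import ring lra.
Import Order.TTheory GRing.Theory Num.Theory.
Import numFieldNormedType.Exports.
Local Open Scope classical_set_scope.
Local Open Scope ring_scope.

(** * Separated boxes and the Hadwiger-Ohmann matching *)

Section Boxes.
Context {R : realType} {n : nat}.
Local Notation bx := ('rV[R]_n * 'rV[R]_n)%type.
Implicit Types (b c P Q : bx) (A B V Z : seq bx) (i : 'I_n) (x s : R).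

Definition bvol b : R := box_vol b.1 b.2.

Definition nondeg b := [forall i, b.1 ord0 i < b.2 ord0 i].

Definition subbox b c :=
  [forall i, (c.1 ord0 i <= b.1 ord0 i) && (b.2 ord0 i <= c.2 ord0 i)].

(** The inequality is weak: boxes that only share a face count as separated, as neighbouring grid
    cells must. *)
Definition before i b c := b.2 ord0 i <= c.1 ord0 i.

Definition sep b c := [exists i, before i b c || before i c b].

Definition tvol A : R := \sum_(b <- A) bvol b.

(** The part of [b] below height [x] in direction [i]. It degenerates when [b] lies above the cut,
    which is why [los] filters first; [hi] and [his] are symmetric. *)
Definition lo i x b : bx :=
  (b.1, \row_j if j == i then Num.min (b.2 ord0 j) x else b.2 ord0 j).

Definition hi i x b : bx :=
  (\row_j if j == i then Num.max (b.1 ord0 j) x else b.1 ord0 j, b.2).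

Definition los i x A := [seq lo i x b | b <- A & b.1 ord0 i < x].
Definition his i x A := [seq hi i x b | b <- A & x < b.2 ord0 i].

Lemma nondegP b : reflect (forall i, b.1 ord0 i < b.2 ord0 i) (nondeg b).
Proof. exact: forallP. Qed.

Lemma subboxP b c : reflect
  (forall i, c.1 ord0 i <= b.1 ord0 i /\ b.2 ord0 i <= c.2 ord0 i) (subbox b c).
Proof.
by apply: (iffP forallP) => h i; [exact/andP | apply/andP].
Qed.

Lemma subbox_refl : reflexive subbox.
Proof. by move=> b; apply/subboxP. Qed.

Lemma subbox_trans : transitive subbox.
Proof.
move=> c b e /subboxP h1 /subboxP h2; apply/subboxP => i.
by have [? ?] := h1 i; have [? ?] := h2 i; split; [apply: le_trans|apply: le_trans]; eauto.
Qed.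

Lemma subbox_lo i x b : subbox (lo i x b) b.
Proof.
by apply/subboxP => j; rewrite !mxE; case: ifP; rewrite ?ge_min lexx.
Qed.

Lemma subbox_hi i x b : subbox (hi i x b) b.
Proof.
by apply/subboxP => j; rewrite !mxE; case: ifP; rewrite ?le_max lexx.
Qed.

Lemma subbox_sep b c b' c' : subbox b b' -> subbox c c' -> sep b' c' -> sep b c.
Proof.
move=> /subboxP sb /subboxP sc /existsP[i h]; apply/existsP; exists i.
have [? ?] := sb i; have [? ?] := sc i.
by case/orP: h; rewrite /before => h; apply/orP; [left|right]; lra.
Qed.

Lemma bvol_gt0 b : nondeg b -> 0 < bvol b.
Proof. by move/nondegP => h; apply: prodr_gt0 => i _; rewrite subr_gt0. Qed.

Lemma tvol_ge0 A : all nondeg A -> 0 <= tvol A.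
Proof.
move=> /allP h; rewrite /tvol big_seq; apply: sumr_ge0 => b /h hb.
exact/ltW/bvol_gt0.
Qed.

Lemma le_bvol b c : nondeg b -> subbox b c -> bvol b <= bvol c.
Proof.
move=> /nondegP hb /subboxP h; apply: ler_prod => i _.
by have := hb i; have [? ?] := h i => ?; apply/andP; split; lra.
Qed.

Lemma nondeg_lo i x b : nondeg b -> b.1 ord0 i < x -> nondeg (lo i x b).
Proof.
move=> /nondegP hb hx; apply/nondegP => j; rewrite !mxE.
by case: eqP => [->|_]; rewrite ?lt_min ?hb ?hx.
Qed.

Lemma nondeg_hi i x b : nondeg b -> x < b.2 ord0 i -> nondeg (hi i x b).
Proof.
move=> /nondegP hb hx; apply/nondegP => j; rewrite !mxE.
by case: eqP => [->|_]; rewrite ?gt_max ?hb ?hx.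
Qed.

Lemma all_los i x A : all nondeg A -> all nondeg (los i x A).
Proof.
move/allP => h; apply/allP => b /mapP[c]; rewrite mem_filter => /andP[hx /h hc] ->.
exact: nondeg_lo.
Qed.

Lemma all_his i x A : all nondeg A -> all nondeg (his i x A).
Proof.
move/allP => h; apply/allP => b /mapP[c]; rewrite mem_filter => /andP[hx /h hc] ->.
exact: nondeg_hi.
Qed.

Lemma bvolD1 i b :
  bvol b = (b.2 ord0 i - b.1 ord0 i) * \prod_(j | j != i) (b.2 ord0 j - b.1 ord0 j).
Proof. by rewrite /bvol /box_vol (bigD1 i). Qed.

Lemma bvol_lo i x b : bvol (lo i x b) =
  (Num.min (b.2 ord0 i) x - b.1 ord0 i) *
  \prod_(j | j != i) (b.2 ord0 j - b.1 ord0 j).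
Proof.
rewrite (bvolD1 i) !mxE eqxx; congr (_ * _).
by apply: eq_bigr => j /negbTE ji; rewrite mxE ji.
Qed.

Lemma bvol_hi i x b : bvol (hi i x b) =
  (b.2 ord0 i - Num.max (b.1 ord0 i) x) *
  \prod_(j | j != i) (b.2 ord0 j - b.1 ord0 j).
Proof.
rewrite (bvolD1 i) !mxE eqxx; congr (_ * _).
by apply: eq_bigr => j /negbTE ji; rewrite mxE ji.
Qed.

(** A discarded box gets the clamped length 0, so the sum can run over all of [A]; in this form the
    volume below the cut is visibly continuous in [x]. *)
Lemma tvol_los i x A : all nondeg A -> tvol (los i x A) =
  \sum_(b <- A) (Num.max (b.1 ord0 i) (Num.min (b.2 ord0 i) x) - b.1 ord0 i) *
  \prod_(j | j != i) (b.2 ord0 j - b.1 ord0 j).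
Proof.
move=> /allP hA; rewrite /tvol big_map big_filter big_mkcond.
rewrite big_seq [RHS]big_seq; apply: eq_bigr => b /hA /nondegP/(_ i) hb.
case: ifP => h; rewrite ?bvol_lo.
  by rewrite [Num.max _ _]max_r // le_min !ltW.
by rewrite max_l ?subrr ?mul0r // ge_min (leNgt x) h orbT.
Qed.

Lemma tvol_cut i x A : all nondeg A ->
  tvol A = tvol (los i x A) + tvol (his i x A).
Proof.
move=> hA'; move/allP: (hA') => hA; rewrite tvol_los //.
rewrite /tvol /his big_map big_filter [X in _ = _ + X]big_mkcond -big_split /=.
rewrite big_seq [RHS]big_seq; apply: eq_bigr => b /hA /nondegP/(_ i) hb.
rewrite bvol_hi (bvolD1 i).
set p := \prod_(_ | _) _.
have [h|h] := ltP x (b.2 ord0 i).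
  rewrite -mulrDl; congr (_ * _).
  by lra.
by rewrite addr0 max_r // ltW.
Qed.


Lemma pairwise_cut (f : bx -> bx) (p : pred bx) A :
  (forall b, subbox (f b) b) -> pairwise sep A ->
  pairwise sep [seq f b | b <- A & p b].
Proof.
move=> hf hA; rewrite pairwise_map.
apply: sub_pairwise (pairwise_filter p hA) => b c /=.
exact: subbox_sep.
Qed.

Lemma pairwise_los i x A : pairwise sep A -> pairwise sep (los i x A).
Proof. by apply: pairwise_cut => b; exact: subbox_lo. Qed.

Lemma pairwise_his i x A : pairwise sep A -> pairwise sep (his i x A).
Proof. by apply: pairwise_cut => b; exact: subbox_hi. Qed.

Lemma tvol_gt0 A : all nondeg A -> (0 < size A)%N -> 0 < tvol A.
Proof.
case: A => //= b A /andP[hb hA] _; rewrite /tvol big_cons.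
exact: ltr_pwDl (bvol_gt0 _ hb) (tvol_ge0 _ hA).
Qed.

Lemma size_cut_lt (f : bx -> bx) (p : pred bx) A b :
  b \in A -> ~~ p b -> (size [seq f b | b <- A & p b] < size A)%N.
Proof.
move=> hb pb; rewrite size_map size_filter -(count_predC p A) -[X in (X < _)%N]addn0.
by rewrite ltn_add2l -has_count; apply/hasP; exists b.
Qed.

Lemma size_cut_gt0 (f : bx -> bx) (p : pred bx) A b :
  b \in A -> p b -> (0 < size [seq f b | b <- A & p b])%N.
Proof.
by move=> hb pb; rewrite size_map size_filter -has_count; apply/hasP; exists b.
Qed.

(** Take [b] before [c] in direction [i] and cut at the upper face of [b]: [c] disappears from the
    low side and [b] from the high side. *)
Lemma sep_cut A : all nondeg A -> pairwise sep A -> (1 < size A)%N ->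
  exists i x, [/\ (size (los i x A) < size A)%N, (size (his i x A) < size A)%N,
    (0 < size (los i x A))%N & (0 < size (his i x A))%N].
Proof.
move=> hA sA szA.
have [b [c [i [bA cA bc]]]] : exists b c i, [/\ b \in A, c \in A & before i b c].
  case: A szA sA {hA} => [|b [|c A]] //= _ /andP[/andP[/existsP[i /orP[h|h]] _] _].
    by exists b, c, i; rewrite !inE !eqxx orbT.
  by exists c, b, i; rewrite !inE !eqxx orbT.
have /allP h := hA.
have /nondegP/(_ i) hb := h _ bA; have /nondegP/(_ i) hc := h _ cA.
move: bc; rewrite /before => bc.
exists i, (b.2 ord0 i); split.
- by apply: size_cut_lt cA _; rewrite -leNgt.
- by apply: size_cut_lt bA _; rewrite ltxx.
- exact: size_cut_gt0 bA _.
- by apply: size_cut_gt0 cA _; exact: le_lt_trans bc hc.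
Qed.


Lemma nondeg_subbox b c : subbox b c -> nondeg b -> nondeg c.
Proof.
move=> /subboxP h /nondegP hb; apply/nondegP => i.
by have [? ?] := h i; have ? := hb i; lra.
Qed.

Lemma all_los_subbox i x Z v :
  all (subbox^~ v) Z -> all (subbox^~ (lo i x v)) (los i x Z).
Proof.
move/allP => h; apply/allP => b /mapP[c]; rewrite mem_filter.
move=> /andP[_ /h/subboxP hc] ->; apply/subboxP => j; have [? h2] := hc j.
rewrite !mxE; case: ifP => _; split => //.
by rewrite le_min !ge_min lexx orbT h2.
Qed.

Lemma all_his_subbox i x Z v :
  all (subbox^~ v) Z -> all (subbox^~ (hi i x v)) (his i x Z).
Proof.
move/allP => h; apply/allP => b /mapP[c]; rewrite mem_filter.
move=> /andP[_ /h/subboxP hc] ->; apply/subboxP => j; have [h1 ?] := hc j.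
rewrite !mxE; case: ifP => _; split => //.
by rewrite ge_max !le_max lexx orbT h1.
Qed.

Lemma nondeg_all_subbox Z v :
  all nondeg Z -> all (subbox^~ v) Z -> (0 < size Z)%N -> nondeg v.
Proof.
by case: Z => //= b Z /andP[hb _] /andP[bv _] _; exact: nondeg_subbox bv hb.
Qed.

Lemma bvol_cut i x v : nondeg (lo i x v) -> nondeg (hi i x v) ->
  bvol v = bvol (lo i x v) + bvol (hi i x v).
Proof.
move=> /nondegP/(_ i) + /nondegP/(_ i); rewrite !mxE eqxx lt_min gt_max.
move=> /andP[_ h1] /andP[_ h2]; rewrite bvol_lo bvol_hi (bvolD1 i) -mulrDl.
congr (_ * _); rewrite min_r ?ltW // max_r ?ltW //; ring.
Qed.

(** Induction on the number of boxes: a hyperplane separating two of them cuts both [Z] and [v], and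
    volumes add up over the two sides. *)
Lemma tvol_packing_box Z v : all nondeg Z -> pairwise sep Z -> nondeg v ->
  all (subbox^~ v) Z -> tvol Z <= bvol v.
Proof.
have [k] := ubnP (size Z); elim: k => // k IH in Z v *.
rewrite ltnS => szk hZ sZ hv sub.
have [sz|sz] := ltnP 1 (size Z); last first.
  case: Z hZ sub sz {szk sZ} => [|b [|]] //= => [_ _ _|].
    by rewrite /tvol big_nil; exact/ltW/bvol_gt0.
  by rewrite !andbT => hb bv _; rewrite /tvol big_seq1; exact: le_bvol.
have [i [x [szl szh l0 h0]]] := sep_cut Z hZ sZ sz.
have al := all_los i x _ hZ; have ah := all_his i x _ hZ.
have sl := all_los_subbox i x _ _ sub; have sh := all_his_subbox i x _ _ sub.
have nl := nondeg_all_subbox _ _ al sl l0.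
have nh := nondeg_all_subbox _ _ ah sh h0.
rewrite (tvol_cut i x) // (bvol_cut i x) //; apply: lerD.
  by apply: IH => //; [exact: leq_trans szl szk | exact: pairwise_los].
by apply: IH => //; [exact: leq_trans szh szk | exact: pairwise_his].
Qed.

(** The boxes of [V] may overlap: those of [Z] inside the first box of [V] are charged to it, the
    remaining ones to the rest of [V]. *)
Lemma tvol_packing Z V : all nondeg Z -> pairwise sep Z -> all nondeg V ->
  all (fun b => has (subbox b) V) Z -> tvol Z <= tvol V.
Proof.
elim: V Z => [|v V IH] Z hZ sZ.
  case: Z {hZ sZ} => // _ _; exact: lexx.
move=> /= /andP[hv hV] /allP sub.
rewrite {2}/tvol big_cons -/(tvol V) /tvol (bigID (subbox^~ v)) /=.
rewrite -!(big_filter Z) -!/(tvol _); apply: lerD.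
  apply: tvol_packing_box => //; last exact: filter_all.
    by rewrite all_filter; apply: sub_all hZ => b /= ->; rewrite implybT.
  exact: pairwise_filter.
apply: IH => //.
    by rewrite all_filter; apply: sub_all hZ => b /= ->; rewrite implybT.
  exact: pairwise_filter.
rewrite all_filter; apply/allP => b /sub /= /orP[-> //|->].
exact: implybT.
Qed.

(** Intermediate value theorem: the volume below the cut varies continuously from 0, at a height
    [- a] below every box, to the total, at a height [a] above every box. *)
Lemma exists_cut_tvol i B r : all nondeg B -> 0 <= r <= tvol B ->
  exists x, tvol (los i x B) = r.
Proof.
move=> hB hr.
have [a [a0 ha]] : exists a, 0 <= a /\
    forall b, b \in B -> - a <= b.1 ord0 i /\ b.2 ord0 i <= a.
  elim: B {hB hr} => [|b B [a [a0 ha]]]; first by exists 0.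
  exists (Num.max a (Num.max (- b.1 ord0 i) (b.2 ord0 i))).
  split=> [|c]; first by rewrite le_max a0.
  rewrite inE => /orP[/eqP ->|/ha [h1 h2]].
    by rewrite lerNl !le_max !lexx !orbT.
  by rewrite lerNl !le_max (lerNl _ a) h1 h2.
have /allP hB' := hB.
pose f x := tvol (los i x B).
have f0 : f (- a) = 0.
  rewrite /f tvol_los // big_seq big1 // => b bB.
  have [h1 _] := ha _ bB; rewrite max_l ?subrr ?mul0r //.
  by rewrite ge_min h1 orbT.
have fa : f a = tvol B.
  rewrite /f tvol_los // /tvol big_seq [RHS]big_seq; apply: eq_bigr => b bB.
  have [_ h2] := ha _ bB; have /nondegP/(_ i) hb := hB' _ bB.
  by rewrite [Num.min _ _]min_l // max_r ?(bvolD1 i) // ltW.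
have cf : continuous f.
  rewrite (_ : f = fun x => \sum_(b <- B)
      (Num.max (b.1 ord0 i) (Num.min (b.2 ord0 i) x) - b.1 ord0 i) *
      \prod_(j | j != i) (b.2 ord0 j - b.1 ord0 j)); last first.
    by apply/funext => x; exact: tvol_los.
  move=> x; apply: (@cvg_big _ _ +%R) => [|b _].
    exact: add_continuous.
  apply: cvgMl; apply: cvgB; last exact: cvg_cst.
  apply: (@continuous_comp _ _ _ (fun x => Num.min (b.2 ord0 i) x)
    (fun x => Num.max (b.1 ord0 i) x)).
    by apply: continuous_min; [exact: cvg_cst | exact: cvg_id].
  by apply: continuous_max; [exact: cvg_cst | exact: cvg_id].
have [|||x _ fx] := @IVT R f (- a) a r.
- lra.
- exact: continuous_subspaceT.
- have ? := tvol_ge0 _ hB.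
  by rewrite f0 fa min_l // max_r.
by exists x.
Qed.

(** * Matched families of boxes *)

Lemma sub_has_subbox b A A' :
  (forall c, c \in A -> exists2 c', c' \in A' & subbox c c') ->
  has (subbox b) A -> has (subbox b) A'.
Proof.
move=> h /hasP[c /h[c' c'A cc'] bc]; apply/hasP; exists c' => //.
exact: subbox_trans bc cc'.
Qed.

Lemma has_los i x A b : has (subbox b) (los i x A) -> has (subbox b) A.
Proof.
apply: sub_has_subbox => c /mapP[c']; rewrite mem_filter => /andP[_ c'A] ->.
by exists c' => //; exact: subbox_lo.
Qed.

Lemma has_his i x A b : has (subbox b) (his i x A) -> has (subbox b) A.
Proof.
apply: sub_has_subbox => c /mapP[c']; rewrite mem_filter => /andP[_ c'A] ->.
by exists c' => //; exact: subbox_hi.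
Qed.

Lemma has_los_le i x A b : has (subbox b) (los i x A) -> b.2 ord0 i <= x.
Proof.
move=> /hasP[c /mapP[c' _ ->] /subboxP/(_ i)[_]]; rewrite mxE eqxx.
by rewrite le_min => /andP[].
Qed.

Lemma has_his_ge i x A b : has (subbox b) (his i x A) -> x <= b.1 ord0 i.
Proof.
move=> /hasP[c /mapP[c' _ ->] /subboxP/(_ i)[]]; rewrite mxE eqxx.
by rewrite ge_max => /andP[].
Qed.

(* One coordinate separates both components in the same order, so that the
   interpolated boxes are separated by it at every time. *)
Definition psep (p q : bx * bx) :=
  [exists i, before i p.1 q.1 && before i p.2 q.2
          || before i q.1 p.1 && before i q.2 p.2].

Definition swap (p : bx * bx) : bx * bx := (p.2, p.1).

(** The outcome of the cutting. The two sums say that no volume is lost; the common ratio, stated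
    without division, makes the same side the smaller one in every pair. *)
Record matching A B (L : seq (bx * bx)) : Prop := Matching {
  matching_nondeg p : p \in L -> nondeg p.1 /\ nondeg p.2;
  matching_sub p : p \in L -> has (subbox p.1) A /\ has (subbox p.2) B;
  matching_ratio p : p \in L -> bvol p.1 * tvol B = bvol p.2 * tvol A;
  matching_tvol1 : \sum_(p <- L) bvol p.1 = tvol A;
  matching_tvol2 : \sum_(p <- L) bvol p.2 = tvol B;
  matching_sep : pairwise psep L }.

Lemma matchingC A B L : matching A B L -> matching B A (map swap L).
Proof.
case=> h1 h2 h3 h4 h5 h6; split.
- by move=> _ /mapP[p /h1[? ?] ->].
- by move=> _ /mapP[p /h2[? ?] ->].
- by move=> _ /mapP[p /h3 ? ->].
- by rewrite big_map.
- by rewrite big_map.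
rewrite pairwise_map; apply: sub_pairwise h6 => p q /existsP[i h].
by apply/existsP; exists i; rewrite /= andbC [X in _ || X]andbC.
Qed.

(** Pairs of [L] lie below both cuts and pairs of [L'] above both, so direction [i] separates them.
    The ratio hypothesis makes the ratio inside each part that of the totals. *)
Lemma matching_cut i x y A B L L' : all nondeg A -> all nondeg B ->
  0 < tvol (los i x A) -> 0 < tvol (his i x A) ->
  tvol (los i x A) * tvol B = tvol (los i y B) * tvol A ->
  matching (los i x A) (los i y B) L -> matching (his i x A) (his i y B) L' ->
  matching A B (L ++ L').
Proof.
move=> hA hB l0 h0 ratio [h1 h2 h3 h4 h5 h6] [k1 k2 k3 k4 k5 k6].
have cA := tvol_cut i x A hA; have cB := tvol_cut i y B hB.
(* The high parts inherit the ratio by subtraction from the totals. *)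
have ratio' : tvol (his i x A) * tvol B = tvol (his i y B) * tvol A.
  by rewrite cA cB in ratio *; lra.
split.
- by move=> p; rewrite mem_cat => /orP[/h1|/k1].
- move=> p; rewrite mem_cat => /orP[/h2|/k2] [pA pB].
    by split; [exact: has_los pA | exact: has_los pB].
  by split; [exact: has_his pA | exact: has_his pB].
- move=> p; rewrite mem_cat => /orP[/h3|/k3] e.
    apply: (mulfI (lt0r_neq0 l0)).
    by rewrite mulrCA ratio mulrA e -mulrA mulrCA.
  apply: (mulfI (lt0r_neq0 h0)).
  by rewrite mulrCA ratio' mulrA e -mulrA mulrCA.
- by rewrite big_cat /= h4 k4 -cA.
- by rewrite big_cat /= h5 k5 -cB.
rewrite pairwise_cat h6 k6 !andbT; apply/allrelP => p q /h2[p1 p2] /k2[q1 q2].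
apply/existsP; exists i; apply/orP; left; rewrite /before.
apply/andP; split.
  exact: le_trans (has_los_le _ _ _ _ p1) (has_his_ge _ _ _ _ q1).
exact: le_trans (has_los_le _ _ _ _ p2) (has_his_ge _ _ _ _ q2).
Qed.

Lemma tvol_gt0_size A : 0 < tvol A -> (0 < size A)%N.
Proof. by case: A => //; rewrite /tvol big_nil ltxx. Qed.

(* A hyperplane separating two boxes of A cuts A into two families with fewer
   boxes; cut B by the parallel hyperplane leaving the same volume ratio on both
   sides, and recurse, exchanging the roles of A and B once A is a single box. *)
Lemma exists_matching A B : all nondeg A -> all nondeg B ->
  pairwise sep A -> pairwise sep B -> (0 < size A)%N -> (0 < size B)%N ->
  exists L, matching A B L.
Proof.
have [k] := ubnP (size A + size B)%N; elim: k => // k IH in A B *.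
rewrite ltnS => szk hA hB sA sB A0 B0.
(* Only the case of a single box in [A] against several in [B] is left out, and exchanging the two
   families reduces it to the first alternative. *)
wlog szA : A B szk hA hB sA sB A0 B0 /
    (1 < size A)%N \/ (size A <= 1)%N /\ (size B <= 1)%N.
  move=> H; have [h|h] := ltnP 1 (size A); first by apply: H => //; left.
  have [h'|h'] := ltnP 1 (size B); last by apply: H => //; right.
  have [||L hL] := H B A _ hB hA sB sA B0 A0; [by rewrite addnC|by left|].
  by exists (map swap L); exact: matchingC.
case: szA => [szA|[szA szB]]; last first.
  case: A hA szA A0 {szk sA} => [|P []] //= /andP[hP _] _ _.
  case: B hB szB B0 {sB} => [|Q []] //= /andP[hQ _] _ _.
  exists [:: (P, Q)]; split; rewrite ?big_seq1 /tvol ?big_seq1 //.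
  - by move=> p; rewrite inE => /eqP ->.
  - by move=> p; rewrite inE => /eqP -> /=; rewrite !subbox_refl.
  - by move=> p; rewrite inE => /eqP -> /=; rewrite mulrC.
have [i [x [szl szh l0 h0]]] := sep_cut A hA sA szA.
have al := all_los i x _ hA; have ah := all_his i x _ hA.
have tl := tvol_gt0 _ al l0; have th := tvol_gt0 _ ah h0.
have tA := tvol_gt0 _ hA A0; have tB := tvol_gt0 _ hB B0.
have cA := tvol_cut i x A hA.
have r0 : 0 < tvol (los i x A) / tvol A by rewrite divr_gt0.
have r1 : tvol (los i x A) / tvol A < 1 by rewrite ltr_pdivrMr // mul1r; lra.
(* The cut of [B] leaves below it the same fraction of volume as the cut of [A]. *)
have [|y hy] := exists_cut_tvol i B (tvol (los i x A) / tvol A * tvol B) hB.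
  by apply/andP; split; [apply: mulr_ge0 | apply: ler_piMl]; exact: ltW.
have cB := tvol_cut i y B hB.
have bl := all_los i y _ hB; have bh := all_his i y _ hB.
have tl' : 0 < tvol (los i y B) by rewrite hy mulr_gt0.
have th' : 0 < tvol (his i y B).
  have : tvol (los i y B) < tvol B by rewrite hy gtr_pMl.
  by lra.
(* Cutting never adds boxes to [B], while both parts of [A] have fewer boxes than [A], so the
   induction measure drops. *)
have szlB : (size (los i y B) <= size B)%N by rewrite size_map size_filter count_size.
have szhB : (size (his i y B) <= size B)%N by rewrite size_map size_filter count_size.
have [|L hL] := IH (los i x A) (los i y B) _ al bl (pairwise_los i x _ sA)
    (pairwise_los i y _ sB) l0 (tvol_gt0_size _ tl').
  by apply: leq_trans szk; rewrite -addSn leq_add.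
have [|L' hL'] := IH (his i x A) (his i y B) _ ah bh (pairwise_his i x _ sA)
    (pairwise_his i y _ sB) h0 (tvol_gt0_size _ th').
  by apply: leq_trans szk; rewrite -addSn leq_add.
exists (L ++ L'); apply: matching_cut hL hL' => //.
rewrite hy -!mulrA [tvol B * _]mulrC; congr (_ * _).
by rewrite mulrA mulVf ?mul1r // gt_eqF.
Qed.
End Boxes.

(** * Interpolated boxes, inflation and grids *)

Section Interpolation.
Context {R : realType} {n : nat}.
Local Notation bx := ('rV[R]_n * 'rV[R]_n)%type.
Implicit Types (b c P Q : bx) (A : set 'rV[R]_n) (V Z : seq bx) (i : 'I_n) (r s t x : R).

Definition interp t (p : bx * bx) : bx :=
  ((1 - t) *: p.1.1 + t *: p.2.1, (1 - t) *: p.1.2 + t *: p.2.2).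

Lemma ltr_conv t x1 x2 y1 y2 : 0 <= t <= 1 -> x1 < x2 -> y1 < y2 ->
  (1 - t) * x1 + t * y1 < (1 - t) * x2 + t * y2.
Proof.
move=> /andP[t0 t1] hx hy.
have ? : 0 <= (1 - t) * (x2 - x1) by rewrite mulr_ge0; lra.
have ? : 0 <= t * (y2 - y1) by rewrite mulr_ge0; lra.
have [t0'|t0'] := ltP 0 t.
  by have ? : 0 < t * (y2 - y1); [rewrite mulr_gt0 //; lra | lra].
have -> : t = 0 by lra.
by lra.
Qed.

Lemma ler_conv t x1 x2 y1 y2 : 0 <= t <= 1 -> x1 <= x2 -> y1 <= y2 ->
  (1 - t) * x1 + t * y1 <= (1 - t) * x2 + t * y2.
Proof. by move=> /andP[? ?] ? ?; nra. Qed.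

Lemma nondeg_interp t (p : bx * bx) : 0 <= t <= 1 -> nondeg p.1 -> nondeg p.2 ->
  nondeg (interp t p).
Proof.
move=> ht /nondegP h1 /nondegP h2; apply/nondegP => i; rewrite !mxE.
exact: ltr_conv.
Qed.

Lemma sep_interp t (p q : bx * bx) : 0 <= t <= 1 -> psep p q ->
  sep (interp t p) (interp t q).
Proof.
move=> ht /existsP[i h]; apply/existsP; exists i; rewrite /before !mxE.
by case/orP: h => /andP[h1 h2]; apply/orP; [left|right]; exact: ler_conv.
Qed.

(** Convexity of the exponential: average, at [x] and [y], the tangent line bound taken at the
    intermediate point [m]. *)
Lemma expR_conv t x y : 0 <= t <= 1 ->
  expR ((1 - t) * x + t * y) <= (1 - t) * expR x + t * expR y.
Proof.
move=> /andP[t0 t1]; set m := _ + _.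
have tangent z : expR m * (1 + (z - m)) <= expR z.
  have -> : expR z = expR m * expR (z - m) by rewrite -expRD addrC subrK.
  by rewrite ler_pM2l ?expR_gt0 // expR_ge1Dx.
have -> : expR m = (1 - t) * (expR m * (1 + (x - m))) + t * (expR m * (1 + (y - m))).
  by rewrite /m; ring.
by apply: ler_conv => //; rewrite t0.
Qed.

(** Weighted AM-GM: the minimum of two exponentials is at most the exponential of a weighted mean of
    the exponents, and convexity of [expR] is then applied factor by factor. *)
Lemma prod_conv_ge_min (I : finType) t (a b : I -> R) : 0 <= t <= 1 ->
  (forall j, 0 < a j) -> (forall j, 0 < b j) ->
  Num.min (\prod_j a j) (\prod_j b j) <= \prod_j ((1 - t) * a j + t * b j).
Proof.
move=> ht ha hb.
have lnE (f : I -> R) : (forall j, 0 < f j) -> \prod_j f j = expR (\sum_j ln (f j)).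
  by move=> hf; rewrite expR_sum; apply: eq_bigr => j _; rewrite lnK // posrE.
apply: (@le_trans _ _ (expR ((1 - t) * \sum_j ln (a j) + t * \sum_j ln (b j)))).
  rewrite !lnE // ge_min !ler_expR.
  set x := \sum_j _; set y := \sum_j _; case/andP: ht => t0 t1.
  by have [xy|yx] := leP x y; apply/orP; [left|right]; nra.
rewrite !mulr_sumr -big_split expR_sum; apply: ler_prod => j _.
rewrite expR_ge0 /=; apply: le_trans (expR_conv _ _ _ ht) _.
by rewrite !lnK ?posrE.
Qed.

Lemma bvol_interp t (p : bx * bx) : 0 <= t <= 1 -> nondeg p.1 -> nondeg p.2 ->
  Num.min (bvol p.1) (bvol p.2) <= bvol (interp t p).
Proof.
move=> ht /nondegP h1 /nondegP h2.
have -> : bvol (interp t p) = \prod_(i < n)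
    ((1 - t) * (p.1.2 ord0 i - p.1.1 ord0 i) + t * (p.2.2 ord0 i - p.2.1 ord0 i)).
  by apply: eq_bigr => i _; rewrite !mxE; ring.
by apply: prod_conv_ge_min => // i; rewrite subr_gt0.
Qed.

(** Applied to [(x, x)] it gives the closed sup-norm ball of radius [r] about [x]. *)
Definition inflate r b : bx := (b.1 - const_mx r, b.2 + const_mx r).

(** The total volume is a polynomial in the radius, hence continuous at 0. *)
Lemma inflate_tvol V e : 0 < e ->
  exists2 r, 0 < r & tvol [seq inflate r b | b <- V] <= tvol V + e.
Proof.
move=> e0.
pose g r := tvol [seq inflate r b | b <- V].
have gE r : g r = \sum_(b <- V) \prod_(i < n) (b.2 ord0 i + r - (b.1 ord0 i - r)).
  rewrite /g /tvol big_map; apply: eq_bigr => b _.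
  by apply: eq_bigr => i _; rewrite !mxE.
have cg : continuous g.
  rewrite (funext gE) => x; apply: (@cvg_big _ _ +%R) => [|b _].
    exact: add_continuous.
  apply: (cvg_big (@mul_continuous R)) => i _.
  apply: cvgB; [apply: cvgD | apply: cvgB];
    by [exact: cvg_cst | exact: cvg_id].
have g0 : g 0 = tvol V.
  by rewrite gE; apply: eq_bigr => b _; apply: eq_bigr => i _; rewrite addr0 subr0.
have /cvgrPdist_lt/(_ _ e0) := cg 0.
rewrite g0 => /nbhs_ballP[d /= d0 hd].
exists (d / 2); first by rewrite divr_gt0.
have /hd : ball (0 : R) d (d / 2).
  by rewrite /ball /= sub0r normrN gtr0_norm; lra.
by rewrite /= distrC => /ltr_normlW h; rewrite -/(g _); lra.
Qed.

Definition cell L d N (k : {ffun 'I_n -> 'I_N}) : bx :=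
  (\row_i (- L + (k i)%:R * d), \row_i (- L + (k i).+1%:R * d)).

Lemma sep_cell L d N (k l : {ffun 'I_n -> 'I_N}) : 0 <= d -> k != l ->
  sep (cell L d N k) (cell L d N l).
Proof.
move=> d0 kl; have [i ki] : exists i, k i != l i.
  apply/existsP; rewrite -negb_forall; apply: contra kl => /forallP h.
  by apply/eqP/ffunP => i; exact/eqP.
apply/existsP; exists i; rewrite /before !mxE !lerD2l.
move: ki; rewrite -val_eqE neq_ltn => /orP[h|h]; apply/orP; [left|right];
  by rewrite ler_wpM2r // ler_nat.
Qed.

(** Only the cells of side [d] that meet [A] are kept, so each of them stays within [d], in every
    coordinate, of a point of [A]. *)
Lemma exists_grid A (L d : R) : (forall x : 'rV[R]_n, A x -> forall i, `|x ord0 i| <= L) -> 0 < d ->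
  exists G : seq bx, [/\ all nondeg G, pairwise sep G,
    forall x : 'rV[R]_n, A x -> exists2 b, b \in G & box b.1 b.2 x &
    forall b, b \in G -> exists2 x : 'rV[R]_n, A x &
      forall i, x ord0 i - d <= b.1 ord0 i /\ b.2 ord0 i <= x ord0 i + d].
Proof.
(* This makes [N * d] exceed [2 * L], so the cells reach from [- L] past [L]. *)
move=> hA d0; pose N := (Num.truncn ((L + L) / d)).+1.
pose meets k := `[< exists2 x : 'rV[R]_n, A x & box (cell L d N k).1 (cell L d N k).2 x >].
exists [seq cell L d N k | k <- enum {ffun 'I_n -> 'I_N} & meets k]; split.
- apply/allP => _ /mapP[k _ ->]; apply/nondegP => i; rewrite !mxE ltrD2l.
  by rewrite ltr_pM2r // ltr_nat.
- rewrite pairwise_map; apply: pairwise_filter.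
  have := enum_uniq {ffun 'I_n -> 'I_N}; rewrite uniq_pairwise.
  by apply: sub_pairwise => k l /= kl; exact: sep_cell (ltW d0) kl.
- move=> x Ax.
  have hx i : 0 <= (x ord0 i + L) / d <= (L + L) / d.
    have := hA _ Ax i; rewrite ler_norml => /andP[h1 h2].
    by apply/andP; split; [apply: divr_ge0; lra | rewrite ler_pM2r ?invr_gt0 //; lra].
  have kN i : (Num.truncn ((x ord0 i + L) / d) < N)%N.
    by rewrite ltnS; apply: le_truncn; have /andP[] := hx i.
  pose k : {ffun 'I_n -> 'I_N} := [ffun i => Ordinal (kN i)].
  have kx : box (cell L d N k).1 (cell L d N k).2 x.
    move=> i; rewrite !mxE ffunE /=.
    have /andP[/truncn_itv /andP[h1 h2] _] := hx i.
    move: h1 h2; rewrite ler_pdivlMr // ltr_pdivrMr // => h1 h2.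
    by apply/andP; split; lra.
  exists (cell L d N k) => //; apply: map_f.
  by rewrite mem_filter mem_enum andbT; apply/asboolP; exists x.
- move=> b /mapP[k]; rewrite mem_filter => /andP[/asboolP[x Ax bx_] _] ->.
  exists x => // i; have := bx_ i; rewrite !mxE => /andP[].
  by rewrite -natr1 => h1 h2; split; lra.
Qed.
End Interpolation.

(** * Counting times along a segment *)

Section Counting.
Context {R : realType}.

(* Between the last visit to [a] before the first visit to [b], and that visit
   to [b], only [w] can hold. *)
Lemma count_between (M : nat) (a b w : pred nat) (r : R) : a 0%N -> b M ->
  (forall j, (j <= M)%N -> [|| a j, b j | w j]) ->
  (forall i j, (i <= M)%N -> (j <= M)%N -> a i -> b j -> r <= `|i%:R - j%:R|) ->
  r - 1 <= (\sum_(0 <= j < M) w j)%:R.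
Proof.
move=> a0 bM cov far.
have [j1 bj1 minj1] := ex_minnP (ex_intro b M bM).
have j1M : (j1 <= M)%N by exact: minj1.
have exi : exists i, a i && (i <= j1)%N by exists 0%N; rewrite a0.
have bnd i : a i && (i <= j1)%N -> (i <= j1)%N by case/andP.
have [j0 /andP[aj0 j01] maxj0] := ex_maxnP exi bnd.
have j0M := leq_trans j01 j1M.
have hr : r <= j1%:R - j0%:R.
  by have := far _ _ j0M j1M aj0 bj1; rewrite distrC ger0_norm // subr_ge0 ler_nat.
have [e|j01'] := eqVneq j0 j1.
  apply: (@le_trans _ _ 0); last exact: ler0n.
  by move: hr; rewrite e; lra.
have {}j01 : (j0 < j1)%N by rewrite ltn_neqAle j01'.
(* Only the indices strictly between [j0] and [j1] are counted, hence the loss of 1. *)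
apply: (@le_trans _ _ (j1 - j0.+1)%:R).
  by rewrite natrB // -natr1; lra.
rewrite ler_nat (big_cat_nat (n := j0.+1)) ?(leq_trans j01) //=.
rewrite (big_cat_nat (n := j1) (m := j0.+1)) //= addnCA.
apply: leq_trans (leq_addr _ _).
rewrite -[X in (X <= _)%N]muln1 -sum_nat_const_nat big_nat [X in (_ <= X)%N]big_nat.
apply: leq_sum => j /andP[h1 h2].
have := cov j (leq_trans (ltnW h2) j1M).
have -> : a j = false.
  apply/negbTE/negP => aj; have := maxj0 j; rewrite aj (ltnW h2) => /(_ isT).
  by rewrite leqNgt h1.
have -> : b j = false.
  by apply/negbTE/negP => /minj1; rewrite leqNgt h2.
by move=> /= ->.
Qed.
End Counting.

(** * The Euclidean norm *)

Section Enorm.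
Context {R : realType} {n : nat}.
Implicit Types x y : 'rV[R]_n.

Lemma sqr_sum_ge0 x : 0 <= \sum_(i < n) x ord0 i ^+ 2.
Proof. by apply: sumr_ge0 => i _; exact: sqr_ge0. Qed.

Lemma enorm_ge0 x : 0 <= enorm x.
Proof. exact: sqrtr_ge0. Qed.

Lemma sqr_enorm x : enorm x ^+ 2 = \sum_(i < n) x ord0 i ^+ 2.
Proof. by rewrite sqr_sqrtr // sqr_sum_ge0. Qed.

Lemma enormZ c x : enorm (c *: x) = `|c| * enorm x.
Proof.
rewrite -sqrtr_sqr -sqrtrM ?sqr_ge0 // mulr_sumr; congr Num.sqrt.
by apply: eq_bigr => i _; rewrite mxE exprMn.
Qed.

Lemma enormN x : enorm (- x) = enorm x.
Proof. by rewrite -scaleN1r enormZ normrN1 mul1r. Qed.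

(** Cauchy-Schwarz: expand the squared norm of [enorm y *: x - enorm x *: y], after setting aside
    vectors of norm 0. *)
Lemma enorm_dot_le x y : \sum_(i < n) x ord0 i * y ord0 i <= enorm x * enorm y.
Proof.
have [x0|x0] := eqVneq (enorm x) 0.
  rewrite x0 mul0r big1 // => i _.
  have /eqP := sqr_enorm x; rewrite x0 expr0n eq_sym psumr_eq0; last first.
    by move=> j _; exact: sqr_ge0.
  by move=> /allP/(_ i (mem_index_enum _)); rewrite sqrf_eq0 => /eqP ->; rewrite mul0r.
have [y0|y0] := eqVneq (enorm y) 0.
  rewrite y0 mulr0 big1 // => i _.
  have /eqP := sqr_enorm y; rewrite y0 expr0n eq_sym psumr_eq0; last first.
    by move=> j _; exact: sqr_ge0.
  by move=> /allP/(_ i (mem_index_enum _)); rewrite sqrf_eq0 => /eqP ->; rewrite mulr0.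
have xy : 0 < enorm x * enorm y by rewrite mulr_gt0 // lt0r enorm_ge0 ?x0 ?y0.
have : 0 <= \sum_(i < n) (enorm y * x ord0 i - enorm x * y ord0 i) ^+ 2.
  by apply: sumr_ge0 => i _; exact: sqr_ge0.
rewrite (_ : \sum_(i < n) _ = enorm y ^+ 2 * \sum_(i < n) x ord0 i ^+ 2
   - 2 * (enorm x * enorm y) * \sum_(i < n) x ord0 i * y ord0 i
   + enorm x ^+ 2 * \sum_(i < n) y ord0 i ^+ 2); last first.
  rewrite !mulr_sumr -sumrB -big_split; apply: eq_bigr => i _ /=; ring.
rewrite -!sqr_enorm => h; rewrite -(ler_pM2l xy); lra.
Qed.

Lemma ler_enormD x y : enorm (x + y) <= enorm x + enorm y.
Proof.
rewrite -(@ler_pXn2r _ 2) ?nnegrE ?addr_ge0 ?enorm_ge0 //.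
rewrite sqr_enorm (_ : \sum_(i < n) _ = \sum_(i < n) x ord0 i ^+ 2
   + 2 * \sum_(i < n) x ord0 i * y ord0 i + \sum_(i < n) y ord0 i ^+ 2); last first.
  by rewrite mulr_sumr -!big_split; apply: eq_bigr => i _ /=; rewrite mxE; ring.
rewrite -!sqr_enorm; have := enorm_dot_le x y; lra.
Qed.

(** A crude comparison with the sup norm: the factor [n] avoids a square root. *)
Lemma enorm_le x (e : R) : 0 <= e -> (forall i, `|x ord0 i| <= e) ->
  enorm x <= n%:R * e.
Proof.
move=> e0 h; have ne : 0 <= n%:R * e by rewrite mulr_ge0.
rewrite -(@ler_pXn2r _ 2) ?nnegrE ?enorm_ge0 // sqr_enorm.
apply: (@le_trans _ _ (\sum_(i < n) e ^+ 2)).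
  by apply: ler_sum => i _; rewrite -real_normK ?num_real // ler_pXn2r ?nnegrE.
rewrite sumr_const card_ord -[e ^+ 2 *+ n]mulr_natl exprMn ler_wpM2r ?sqr_ge0 //.
by rewrite -natrX ler_nat; case: (n) => // k; rewrite leq_pmulr.
Qed.

Lemma norm_coord x i : `|x ord0 i| <= `|x|.
Proof.
rewrite [`|x|]mx_normrE.
by apply: (le_bigmax _ (fun ij : 'I_1 * 'I_n => `|x ij.1 ij.2|) (ord0, i)).
Qed.
End Enorm.

(** * Averaging the moving boxes over time *)

Section Estimate.
Context {R : realType} {n : nat}.
Local Notation bx := ('rV[R]_n * 'rV[R]_n)%type.
Implicit Types (A B V : seq bx) (L : seq (bx * bx)).

(** Since the ratio is constant, the minimum is attained on the same side in all pairs, and that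
    side sums to its total volume. *)
Lemma matching_sum_min A B L : matching A B L -> 0 < tvol A -> 0 < tvol B ->
  \sum_(p <- L) Num.min (bvol p.1) (bvol p.2) = Num.min (tvol A) (tvol B).
Proof.
move=> [h1 _ h3 h4 h5 _] A0 B0.
have [AB|BA] := leP (tvol A) (tvol B).
  rewrite -h4 big_seq [RHS]big_seq; apply: eq_bigr => p pL.
  apply: min_l; rewrite -(ler_pM2r B0) h3 // ler_wpM2l //.
  by have [_ /bvol_gt0/ltW] := h1 _ pL.
rewrite -h5 big_seq [RHS]big_seq; apply: eq_bigr => p pL.
apply: min_r; rewrite -(ler_pM2r A0) -h3 // ler_wpM2l // ltW //.
by have [/bvol_gt0] := h1 _ pL.
Qed.

(** Double counting over pairs and times. At a fixed time the interpolated boxes contained in boxes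
    of [V] are separated, so their volumes sum to at most [tvol V]; each pair is counted at no fewer
    than [c] times. *)
Lemma matching_estimate A B L V (M : nat) (c : R) : matching A B L ->
  0 < tvol A -> 0 < tvol B -> all nondeg V -> (0 < M)%N ->
  (forall p, p \in L ->
    c <= (\sum_(0 <= j < M) has (subbox (interp (j%:R / M%:R) p)) V)%:R) ->
  Num.min (tvol A) (tvol B) * c <= M%:R * tvol V.
Proof.
move=> mL A0 B0 hV M0 hc.
have [h1 _ _ _ _ h6] := mL.
pose good j p := has (subbox (interp (j%:R / M%:R) p)) V.
have t01 j : (j < M)%N -> 0 <= (j%:R / M%:R : R) <= 1.
  move=> jM; rewrite divr_ge0 //= ler_pdivrMr ?ltr0n // mul1r ler_nat.
  exact: ltnW.
have step j : (j < M)%N ->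
    \sum_(p <- L) Num.min (bvol p.1) (bvol p.2) * (good j p)%:R <= tvol V.
  move=> jM.
  apply: le_trans (tvol_packing [seq interp (j%:R / M%:R) p | p <- L & good j p] V _ _ hV _).
  - rewrite /tvol big_map big_filter [X in _ <= X]big_mkcond.
    rewrite big_seq [X in _ <= X]big_seq; apply: ler_sum => p pL.
    case: ifP => _; rewrite ?mulr0 // mulr1.
    by have [? ?] := h1 _ pL; apply: bvol_interp => //; exact: t01.
  - apply/allP => b /mapP[p]; rewrite mem_filter => /andP[_ pL] ->.
    by have [? ?] := h1 _ pL; apply: nondeg_interp => //; exact: t01.
  - rewrite pairwise_map; apply: pairwise_filter.
    by apply: sub_pairwise h6 => p q /=; apply: sep_interp; exact: t01.
  - by apply/allP => b /mapP[p]; rewrite mem_filter => /andP[gp _] ->.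
rewrite -(matching_sum_min _ _ _ mL A0 B0) mulr_suml.
apply: (@le_trans _ _ (\sum_(p <- L) \sum_(0 <= j < M)
    Num.min (bvol p.1) (bvol p.2) * (good j p)%:R)).
  rewrite big_seq [X in _ <= X]big_seq; apply: ler_sum => p pL.
  rewrite -mulr_sumr -natr_sum; apply: ler_wpM2l; last exact: hc.
  by have [/bvol_gt0/ltW ? /bvol_gt0/ltW ?] := h1 _ pL; rewrite le_min; apply/andP.
rewrite exchange_big /=; apply: (@le_trans _ _ (\sum_(0 <= j < M) tvol V)).
  by rewrite big_nat [X in _ <= X]big_nat; apply: ler_sum => j /andP[_ /step].
by rewrite sumr_const_nat subn0 mulr_natl.
Qed.
End Estimate.

(** * Outer measure *)

Section Outer.
Context {R : realType} {n : nat}.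
Local Notation bx := ('rV[R]_n * 'rV[R]_n)%type.
Implicit Types (A B S C : set 'rV[R]_n) (V : seq bx).

Lemma box_vol_ge0 (u v : 'rV[R]_n) :
  (forall i, u ord0 i <= v ord0 i) -> 0 <= box_vol u v.
Proof. by move=> uv; apply: prodr_ge0 => i _; rewrite subr_ge0. Qed.

Lemma leb_outer_ge0 A : (0 <= leb_outer A)%E.
Proof.
apply: le_ereal_inf_tmp => _ [u [v [uv _ ->]]].
by apply: nneseries_ge0 => k _ _; rewrite lee_fin; exact: box_vol_ge0.
Qed.

Lemma le_leb_outer A B : A `<=` B -> (leb_outer A <= leb_outer B)%E.
Proof.
move=> AB; apply: ereal_inf_le_tmp => _ [u [v [uv cov ->]]].
by exists u, v; split => //; exact: subset_trans AB cov.
Qed.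

(* For n = 0 every box has volume 1, so [leb_outer] is identically +oo. *)
Lemma leb_outer_le_tvol A V : (0 < n)%N -> all nondeg V ->
  (forall x, A x -> exists2 b, b \in V & box b.1 b.2 x) ->
  (leb_outer A <= (tvol V)%:E)%E.
Proof.
move=> n0 hV cov; pose b k := nth (0, 0) V k.
have bge k i : (b k).1 ord0 i <= (b k).2 ord0 i.
  have [kV|kV] := ltnP k (size V); last by rewrite /b nth_default.
  by apply/ltW; move: i; apply/nondegP; apply: (allP hV); exact: mem_nth.
have ge0 k : (0 <= (box_vol (b k).1 (b k).2)%:E)%E by rewrite lee_fin box_vol_ge0.
apply: ereal_inf_lbound; exists (fun k => (b k).1), (fun k => (b k).2); split => //.
  move=> x /cov[c cV cx]; exists (index c V) => //=.
  by rewrite /b nth_index.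
rewrite (nneseries_split 0 (size V)) // add0n eseries0 ?adde0; last first.
  move=> k kV _; rewrite /b nth_default // /box_vol /=.
  by case: (n) n0 => // m _; rewrite big_ord_recl !mxE subrr mul0r.
by rewrite sumEFin /tvol (big_nth (0, 0)).
Qed.

(** Inflating a nearly optimal countable cover makes compactness applicable; a second inflation of
    the finite cover leaves room for a cube of one fixed radius about every point of [C].
    Near-optimality and the two inflations cost [e / 3] each. *)
Lemma leb_outer_cover C A (e : R) : compact C -> C `<=` A ->
  leb_outer A \is a fin_num -> 0 < e ->
  exists V, exists2 r, 0 < r & [/\ all nondeg V, tvol V <= fine (leb_outer A) + e &
    forall x, C x -> has (subbox (inflate r (x, x))) V].
Proof.
move=> cC CA finA e0; have e3 : 0 < e / 3 by lra.
have [_ [u [v [uv cov ->]]] sum_lt] := lb_ereal_inf_adherent e3 finA.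
(* Geometric weights, summing to [e / 3] over all [k]. *)
pose w k : R := e / 3 / (2 ^ k.+1)%:R.
have w0 k : 0 < w k by rewrite divr_gt0 // ltr0n expn_gt0.
have exr k : exists r, 0 < r /\ bvol (inflate r (u k, v k)) <= box_vol (u k) (v k) + w k.
  have [r r0] := inflate_tvol [:: (u k, v k)] _ (w0 k).
  by rewrite /tvol !big_seq1 => h; exists r.
have [r hr] := choice exr.
(* An open set between the [k]-th box and its inflation. *)
pose f k := \bigcup_(s in box (u k) (v k)) ball s (r k).
have fop k : open (f k) by apply: bigcup_open => s _; apply: ball_open; have [] := hr k.
move: cC; rewrite compact_cover => cC.
have [||K _ CK] := cC nat setT f.
- by move=> k _.
- move=> x /CA/cov[k _ kx]; exists k => //; exists x => //.
  by apply: ballxx; have [] := hr k.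
(* All boxes of index below [N] are taken, which includes the finite subcover. *)
pose N := (\max_(k <- finmap.enum_fset K) k).+1.
pose V0 : seq bx := [seq inflate (r k) (u k, v k) | k <- index_iota 0 N].
have [d d0 hd] := inflate_tvol V0 _ e3.
exists [seq inflate d b | b <- V0], d => //; split.
- apply/allP => _ /mapP[_ /mapP[k _ ->] ->]; apply/nondegP => i; rewrite !mxE.
  by have := uv k i; have [? _] := hr k; lra.
- apply: le_trans hd _.
  have : ((tvol V0)%:E <= leb_outer A + (e / 3)%:E + (e / 3)%:E)%E.
    apply: (@le_trans _ _ (\sum_(0 <= k <oo) ((box_vol (u k) (v k))%:E + (w k)%:E))%E).
      apply: le_trans (nneseries_lim_ge N _); last first.
        move=> k _ _; rewrite -EFinD lee_fin addr_ge0 ?(ltW (w0 k)) //.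
        exact: box_vol_ge0.
      rewrite /tvol big_map -sumEFin; apply: lee_sum => k _.
      by rewrite -EFinD lee_fin; have [] := hr k.
    apply: le_trans (epsilon_trick xpredT _ (ltW e3)) _.
      by move=> k; rewrite lee_fin box_vol_ge0.
    by rewrite leeD2r // ltW.
  by rewrite -(fineK finA) -!EFinD lee_fin /=; lra.
- move=> x /CK[k kK [s sk xs]].
  have kN : (k < N)%N by rewrite ltnS; apply: leq_bigmax_seq.
  apply/hasP; exists (inflate d (inflate (r k) (u k, v k))).
    apply: map_f; apply: (map_f (fun k => inflate (r k) (u k, v k))).
    by rewrite mem_index_iota.
  apply/subboxP => i; rewrite !mxE.
  have /andP[h1 h2] := sk i.
  have : `|s ord0 i - x ord0 i| < r k.
    move: xs; rewrite mx_norm_ball /ball_ => /=; apply: le_lt_trans.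
    by have := norm_coord (s - x) i; rewrite !mxE.
  by rewrite ltr_norml => /andP[h3 h4]; split; lra.
Qed.

End Outer.

Lemma compact_coord_bounded (R : realType) (n : nat) (S : set 'rV[R]_n) :
  compact S -> exists L, forall x, S x -> forall i, `|x ord0 i| <= L.
Proof.
move=> /compact_bounded[N [_ hN]]; exists (N + 1) => x Sx i.
by apply: le_trans (norm_coord x i) _; apply: hN => //; rewrite ltrDl.
Qed.

(** * The separation inequality *)

Section Separation.
Context {R : realType} {n : nat}.
Implicit Types (A B S T : set 'rV[R]_n) (x y z : 'rV[R]_n).

(* [ball] is the sup-norm ball, whence the factors n in comparisons with [enorm]. *)
Definition thicken (r : R) T : set 'rV[R]_n := \bigcup_(x in T) ball x r.

Lemma open_thicken r T : 0 < r -> open (thicken r T).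
Proof. by move=> r0; apply: bigcup_open => x _; exact: ball_open. Qed.

Lemma thickenP r T x : 0 < r -> thicken r T x ->
  exists2 y, T y & enorm (y - x) <= n%:R * r.
Proof.
move=> r0 [y Ty]; rewrite mx_norm_ball /ball_ => /= xy; exists y => //.
apply: enorm_le (ltW r0) _ => i; apply: le_trans (norm_coord _ i) _.
exact: ltW.
Qed.

Lemma thicken_dist r A B x y (d : R) : 0 < r ->
  (forall x y, A x -> B y -> d <= enorm (x - y)) ->
  thicken r A x -> thicken r B y -> d - 2 * n%:R * r <= enorm (x - y).
Proof.
move=> r0 far /(thickenP _ _ _ r0)[a Aa ax] /(thickenP _ _ _ r0)[b Bb yb].
have := far _ _ Aa Bb.
have -> : a - b = (a - x) + ((x - y) + (y - b)).
  by rewrite !addrA subrK subrK.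
have := ler_enormD (a - x) ((x - y) + (y - b)).
have := ler_enormD (x - y) (y - b).
by rewrite -(enormN (y - b)) opprB; lra.
Qed.

(** Removing open thickenings of [S1] and [S2] from [S] leaves a compact part of [S3], which has a
    finite box cover with room [dl]. Grids of mesh [dl] on [A] and [B] are matched, and their
    interpolated boxes follow segments from [A] to [B]. *)
Lemma separation_bound_eps S S1 S2 S3 A B (d D e : R) : (0 < n)%N -> compact S ->
  S `<=` S1 `|` S2 `|` S3 -> leb_outer S3 \is a fin_num ->
  A `<=` S1 -> B `<=` S2 -> A `<=` S -> B `<=` S ->
  (forall x y, A x -> B y -> segment x y `<=` S) ->
  (forall x y, S1 x -> S2 y -> d <= enorm (x - y)) ->
  0 < D -> (forall x y, A x -> B y -> enorm (x - y) <= D) ->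
  0 < e -> e < d ->
  (0 < leb_outer A)%E -> (0 < leb_outer B)%E ->
  leb_outer A \is a fin_num -> leb_outer B \is a fin_num ->
  (d - e) * Num.min (fine (leb_outer A)) (fine (leb_outer B)) <=
    D * (fine (leb_outer S3) + e).
Proof.
move=> n0 cS cover3 fin3 AS1 BS2 AS BS segS far D0 near e0 ed A0 B0 finA finB.
have n0R : 0 < n%:R :> R by rewrite ltr0n.
(* The two thickenings together shorten the distance [d] by [e / 2]. *)
pose r := e / (4 * n%:R).
have r0 : 0 < r by rewrite divr_gt0 // mulr_gt0.
have rE : 2 * n%:R * r = e / 2 by rewrite /r; field; exact: lt0r_neq0.
(* The time step is so fine that the loss of 1 in [count_between] costs another [e / 2]. *)
pose M := (Num.truncn (2 * D / e)).+1.
have M0 : 0 < M%:R :> R by rewrite ltr0n.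
have MD : D / M%:R <= e / 2.
  rewrite ler_pdivrMr //.
  have : 2 * D / e < M%:R by apply: truncnS_gt; rewrite divr_ge0 ?mulr_ge0 ?ltW.
  by rewrite ltr_pdivrMr // => ?; lra.
pose C := S `&` ~` (thicken r S1 `|` thicken r S2).
have cC : compact C.
  apply: compact_closedI => //; apply: open_closedC.
  by apply: openU; exact: open_thicken.
have CS3 : C `<=` S3.
  move=> x [/cover3[[S1x|S2x]|//] nx]; exfalso; apply: nx.
    by left; exists x => //; exact: ballxx.
  by right; exists x => //; exact: ballxx.
have [V [dl dl0 [hV Vvol CV]]] := leb_outer_cover _ _ _ cC CS3 fin3 e0.
have [L SL] := compact_coord_bounded _ _ _ cS.
have [G [nG sG covG meetG]] := exists_grid _ _ _ (fun x Ax => SL x (AS x Ax)) dl0.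
have [H [nH sH covH meetH]] := exists_grid _ _ _ (fun x Bx => SL x (BS x Bx)) dl0.
have AG : fine (leb_outer A) <= tvol G.
  by rewrite -lee_fin fineK //; exact: leb_outer_le_tvol.
have BH : fine (leb_outer B) <= tvol H.
  by rewrite -lee_fin fineK //; exact: leb_outer_le_tvol.
have a0 : 0 < fine (leb_outer A) by rewrite -lte_fin fineK.
have b0 : 0 < fine (leb_outer B) by rewrite -lte_fin fineK.
have G0 := lt_le_trans a0 AG; have H0 := lt_le_trans b0 BH.
have [K mK] := exists_matching _ _ nG nH sG sH (tvol_gt0_size _ G0) (tvol_gt0_size _ H0).
(* Successive sample points are at most [D / M] apart, so crossing a gap of width [d - e / 2] takes
   at least [M / D * (d - e / 2)] steps. *)
have hits p : p \in K -> M%:R / D * (d - e / 2) - 1 <=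
    (\sum_(0 <= j < M) has (subbox (interp (j%:R / M%:R) p)) V)%:R.
  move=> pK; have [pG pH] := matching_sub _ _ _ mK p pK.
  have [P PG /subboxP pP] := hasP pG; have [x Ax xP] := meetG _ PG.
  have [Q QH /subboxP pQ] := hasP pH; have [y By yQ] := meetH _ QH.
  pose z (j : nat) : 'rV[R]_n := (1 - j%:R / M%:R) *: x + (j%:R / M%:R) *: y.
  have z0 : z 0%N = x by rewrite /z mul0r subr0 scale1r scale0r addr0.
  have zM : z M = y by rewrite /z divff ?gt_eqF // subrr scale0r scale1r add0r.
  have t01 j : (j <= M)%N -> 0 <= (j%:R / M%:R : R) <= 1.
    by move=> jM; rewrite divr_ge0 //= ler_pdivrMr // mul1r ler_nat.
  apply: (@count_between R M (fun j => `[< thicken r S1 (z j) >])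
    (fun j => `[< thicken r S2 (z j) >])).
  - by apply/asboolP; rewrite z0; exists x; [exact: AS1 | exact: ballxx].
  - by apply/asboolP; rewrite zM; exists y; [exact: BS2 | exact: ballxx].
  - move=> j jM; case: asboolP => //= n1; case: asboolP => //= n2.
    have Sz : S (z j).
      apply: (segS _ _ Ax By); exists (j%:R / M%:R) => //=.
      by rewrite in_itv /=; exact: t01.
    have /CV/hasP[v vV zv] : C (z j) by split => // -[].
    (* The interpolated box stays within [dl] of [z j] in every coordinate, so it fits in the cube
       about [z j] that lies in [v]. *)
    apply/hasP; exists v => //; apply: subbox_trans zv; apply/subboxP => i.
    have [? ?] := pP i; have [? ?] := pQ i; have [? ?] := xP i; have [? ?] := yQ i.
    rewrite !mxE; set t := _ / _.
    have tt : 0 <= t <= 1 by exact: t01.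
    have -> : (1 - t) * x ord0 i + t * y ord0 i - dl =
        (1 - t) * (x ord0 i - dl) + t * (y ord0 i - dl) by ring.
    have -> : (1 - t) * x ord0 i + t * y ord0 i + dl =
        (1 - t) * (x ord0 i + dl) + t * (y ord0 i + dl) by ring.
    by split; apply: ler_conv => //; lra.
  - move=> i j iM jM /asboolP zi /asboolP zj.
    have := thicken_dist _ _ _ _ _ _ r0 far zi zj; rewrite rE.
    have -> : z i - z j = ((i%:R - j%:R) / M%:R) *: (y - x).
      by apply/rowP => k; rewrite !mxE; ring.
    rewrite enormZ -[y - x]opprB enormN normrM [`|M%:R^-1|]gtr0_norm ?invr_gt0 // => h.
    rewrite mulrAC ler_pdivrMr // mulrC -ler_pdivlMr //.
    apply: le_trans h _; rewrite mulrAC; apply: ler_wpM2r.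
      by rewrite invr_ge0 ltW.
    by apply: ler_wpM2l => //; exact: near.
have := matching_estimate _ _ _ V M _ mK G0 H0 hV (ltn0Sn _) hits.
set m := Num.min (fine _) _; set mGH := Num.min (tvol _) _ => est.
have m0 : 0 <= m by rewrite le_min !ltW.
have mm : m <= mGH by rewrite le_min !ge_min AG BH /= orbT.
rewrite -(ler_pM2l M0) [leRHS]mulrCA.
apply: le_trans (ler_wpM2l (ltW D0) (le_trans est (ler_wpM2l (ltW M0) Vvol))).
have -> : D * (mGH * (M%:R / D * (d - e / 2) - 1)) =
    M%:R * ((d - e / 2 - D / M%:R) * mGH).
  by field; rewrite !gt_eqF.
apply: ler_wpM2l; first exact: ltW.
by apply: ler_pM => //; lra.
Qed.

(** The limit of the previous bound as [e] tends to 0, by contradiction. If the minimum of the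
    volumes is 0 the left side vanishes. *)
Lemma separation_bound S S1 S2 S3 A B (d D : R) : (0 < n)%N -> compact S ->
  S `<=` S1 `|` S2 `|` S3 -> leb_outer S3 \is a fin_num ->
  A `<=` S1 -> B `<=` S2 -> A `<=` S -> B `<=` S ->
  (forall x y, A x -> B y -> segment x y `<=` S) ->
  0 < d -> (forall x y, S1 x -> S2 y -> d <= enorm (x - y)) ->
  0 < D -> (forall x y, A x -> B y -> enorm (x - y) <= D) ->
  leb_outer A \is a fin_num -> leb_outer B \is a fin_num ->
  d * Num.min (fine (leb_outer A)) (fine (leb_outer B)) <=
    D * fine (leb_outer S3).
Proof.
move=> n0 cS cover3 fin3 AS1 BS2 AS BS segS d0 far D0 near finA finB.
have a0 : 0 <= fine (leb_outer A) by rewrite fine_ge0 // leb_outer_ge0.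
have b0 : 0 <= fine (leb_outer B) by rewrite fine_ge0 // leb_outer_ge0.
have s0 : 0 <= fine (leb_outer S3) by rewrite fine_ge0 // leb_outer_ge0.
set m := Num.min _ _; have m0 : 0 <= m by rewrite le_min a0.
have [m_eq0|m_neq0] := eqVneq m 0; first by rewrite m_eq0 mulr0 mulr_ge0 // ltW.
have mgt0 : 0 < m by rewrite lt0r m_neq0.
have [A0 B0] : (0 < leb_outer A)%E /\ (0 < leb_outer B)%E.
  by rewrite -(fineK finA) -(fineK finB) !lte_fin; apply/andP; rewrite -lt_min.
rewrite leNgt; apply/negP => gap.
set g := d * m - D * fine (leb_outer S3).
have g0 : 0 < g by rewrite subr_gt0.
(* Chosen so that [e < d] and the total error [e * (m + D)] is at most half the gap [g]. *)
pose e := Num.min (d / 2) (g / (2 * (m + D))).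
have mD : 0 < m + D by rewrite addr_gt0.
have e0 : 0 < e by rewrite lt_min !divr_gt0 // mulr_gt0.
have ed : e < d by rewrite gt_min; apply/orP; left; lra.
have := separation_bound_eps _ _ _ _ _ _ _ _ _ n0 cS cover3 fin3 AS1 BS2 AS BS segS
  far D0 near e0 ed A0 B0 finA finB.
rewrite -/m => h.
have : e * (m + D) <= g / 2.
  rewrite -ler_pdivlMr // /e ge_min; apply/orP; right.
  by rewrite invfM mulrA.
by rewrite /g in g0 *; nra.
Qed.

End Separation.

(** * Kernels, diameters and the final inequality *)

Lemma kernel_sub (R : realType) (n : nat) (S : set 'rV[R]_n) : Defs.kernel S `<=` S.
Proof. by move=> x []. Qed.

Lemma segmentC (R : realType) (n : nat) (x y : 'rV[R]_n) :
  segment x y `<=` segment y x.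
Proof.
move=> _ [t /= + <-]; rewrite in_itv /= => /andP[t0 t1].
exists (1 - t); first by rewrite /= in_itv /=; apply/andP; split; lra.
by rewrite subKr addrC.
Qed.

Lemma compact_leb_outer_fin (R : realType) (n : nat) (S T : set 'rV[R]_n) :
  (0 < n)%N -> compact S -> T `<=` S -> leb_outer T \is a fin_num.
Proof.
move=> n0 /compact_coord_bounded[L SL] TS.
have [G [nG _ covG _]] := exists_grid _ _ _ SL ltr01.
rewrite ge0_fin_numE ?leb_outer_ge0 //; apply: le_lt_trans (ltry (tvol G)).
by apply: leb_outer_le_tvol => // x /TS/covG.
Qed.

Lemma compact_enorm_le_diam (R : realType) (n : nat) (S : set 'rV[R]_n) x y :
  compact S -> S x -> S y -> enorm (x - y) <= diam S.
Proof.
move=> /compact_coord_bounded[L SL] Sx Sy; apply: ub_le_sup; last by exists x, y.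
exists (n%:R * (`|L| + `|L|)) => _ [a [b [Sa Sb ->]]].
apply: enorm_le => [|i]; first exact: addr_ge0.
rewrite !mxE; apply: le_trans (ler_normB _ _) _.
by apply: lerD; apply: le_trans (ler_norm L); exact: SL.
Qed.

Lemma diam_dim0 (R : realType) (S : set 'rV[R]_0) : diam S <= 0.
Proof.
have [->|/set0P[x Sx]] := eqVneq S set0.
  rewrite /diam (_ : [set r | _] = set0) ?sup0 //.
  by apply/seteqP; split => // r [x [y []]].
apply: ge_sup; first by exists (enorm (x - x)), x, x.
by move=> _ [a [b [_ _ ->]]]; rewrite /enorm big_ord0 sqrtr0.
Qed.

(** Test the measurability of [S1] on [K], then that of [S2] on what is left of [K] outside [S1]. *)
Lemma leb_outer_split3 (R : realType) (n : nat) (K S1 S2 S3 : set 'rV[R]_n) :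
  leb_measurable S1 -> leb_measurable S2 -> S1 `&` S2 = set0 ->
  K `<=` S1 `|` S3 `|` S2 ->
  (leb_outer K <= leb_outer (K `&` S1) + (leb_outer (K `&` S2) + leb_outer S3))%E.
Proof.
move=> m1 m2 d12 KS; rewrite (m1 K) (m2 (K `&` ~` S1)).
rewrite leeD2l //; apply: leeD.
  by apply: le_leb_outer => x [[Kx _] S2x].
by apply: le_leb_outer => x [[Kx n1] n2]; case: (KS x Kx) => // -[].
Qed.

(** Here [k1] and [k2] stand for the volumes of the kernel inside [S1] and [S2]. If [v1] or [v2]
    attains its minimum, that bound and [k <= s] suffice. Otherwise [k1], [k2] and [s3], each
    multiplied by [d], are at most [D * s3], so [d * k <= 3 * (D * s3)], and the minimum of [v1] and
    [v2] is at most [s]. *)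
Lemma ratio_bound (R : realFieldType) (D d s s3 v1 v2 k k1 k2 : R) :
  0 < d -> d <= D -> 0 < s -> 0 <= k -> k <= s -> v1 <= s -> v2 <= s ->
  0 <= s3 -> 0 <= v1 -> 0 <= v2 -> k <= k1 + (k2 + s3) ->
  d * Num.min v1 k2 <= D * s3 -> d * Num.min v2 k1 <= D * s3 ->
  k / s / (4 * D) * d * Num.min v1 v2 <= s3.
Proof.
move=> d0 dD s0 k0 ks v1s v2s s30 v10 v20 kk b1 b2.
have D0 : 0 < D by exact: lt_le_trans dD.
set m := Num.min v1 v2.
have m0 : 0 <= m by rewrite le_min v10.
have ms : m <= s by rewrite ge_min v1s.
have dm0 : 0 <= d * m by rewrite mulr_ge0 // ltW.
have dk0 : 0 <= d * k by rewrite mulr_ge0 // ltW.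
have Ds0 : 0 <= D * s3 by rewrite mulr_ge0 // ltW.
have small v : m <= v -> d * v <= D * s3 -> d * m * k <= D * s3 * s.
  move=> mv h; apply: ler_pM => //; apply: le_trans h.
  by apply: ler_wpM2l => //; exact: ltW.
have key : d * m * k <= 4 * (D * s3 * s).
  have p0 : 0 <= D * s3 * s by rewrite mulr_ge0 // ltW.
  have [h1|h1] := leP v1 k2.
    rewrite min_l // in b1.
    by have := small v1 _ b1; rewrite ge_min lexx => /(_ isT); lra.
  have [h2|h2] := leP v2 k1.
    rewrite min_l // in b2.
    by have := small v2 _ b2; rewrite ge_min lexx orbT => /(_ isT); lra.
  rewrite (min_r (ltW h1)) in b1; rewrite (min_r (ltW h2)) in b2.
  have b3 : d * s3 <= D * s3 by apply: ler_wpM2r.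
  have dk : d * k <= 3 * (D * s3).
    have : d * k <= d * (k1 + (k2 + s3)) by apply: ler_wpM2l => //; exact: ltW.
    by lra.
  have : d * k * m <= 3 * (D * s3) * s by apply: ler_pM.
  by lra.
have -> : k / s / (4 * D) * d * m = (d * m * k) / (4 * D * s).
  by field; rewrite !gt_eqF.
by rewrite ler_pdivrMr ?mulr_gt0 //; lra.
Qed.

Theorem theorem1p1 (R : realType) (n : nat) (S S1 S2 S3 : set 'rV[R]_n) :
  star_shaped_body S -> 0 < star_ratio S ->
  leb_measurable S1 -> leb_measurable S2 -> leb_measurable S3 ->
  S1 `&` S2 = set0 -> S1 `&` S3 = set0 -> S2 `&` S3 = set0 ->
  S1 `|` S3 `|` S2 = S ->
  (vol S3 >= (star_ratio S / (4 * diam S))%:E * set_dist S1 S2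
               * Order.min (vol S1) (vol S2))%E.
Proof.
move=> [[cS _ _] _] eta0 m1 m2 _ d12 _ _ SE; rewrite /vol.
have S1S : S1 `<=` S by rewrite -SE => x; left; left.
have S2S : S2 `<=` S by rewrite -SE => x; right.
have S3S : S3 `<=` S by rewrite -SE => x; left; right.
(* In dimension 0 the diameter is at most 0, so the coefficient is nonpositive and the other factors
   are nonnegative. *)
have [n0|n0] := posnP n.
  subst n; apply: le_trans (leb_outer_ge0 S3).
  have dist0 : (0 <= set_dist S1 S2)%E.
    by apply: le_ereal_inf_tmp => _ [x [y [_ _ ->]]]; rewrite lee_fin enorm_ge0.
  apply: mule_le0_ge0; last by rewrite le_min !leb_outer_ge0.
  apply: mule_le0_ge0 => //; rewrite lee_fin.
  apply: mulr_ge0_le0; first exact: ltW.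
  by rewrite invr_le0 pmulr_rle0 // diam_dim0.
have fin T : T `<=` S -> leb_outer T \is a fin_num by exact: compact_leb_outer_fin.
have out0 : leb_outer (@set0 'rV[R]_n) = 0%E.
  apply/eqP; rewrite eq_le leb_outer_ge0 andbT.
  apply: le_trans (leb_outer_le_tvol set0 [::] n0 isT _) _; first by move=> x [].
  by rewrite /tvol big_nil.
have dist0 : (0 <= set_dist S1 S2)%E.
  by apply: le_ereal_inf_tmp => _ [x [y [_ _ ->]]]; rewrite lee_fin enorm_ge0.
(* With an empty part the distance is [+oo], but the minimum of the volumes is 0 and the product is
   0 by convention. *)
have [S10|/set0P[x1 S1x1]] := eqVneq S1 set0.
  by rewrite S10 out0 min_l ?leb_outer_ge0 // mule0 leb_outer_ge0.
have [S20|/set0P[x2 S2x2]] := eqVneq S2 set0.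
  by rewrite S20 out0 min_r ?leb_outer_ge0 // mule0 leb_outer_ge0.
have dist_le x y : S1 x -> S2 y -> (set_dist S1 S2 <= (enorm (x - y))%:E)%E.
  by move=> S1x S2y; apply: ereal_inf_lbound; exists x, y.
have finD : set_dist S1 S2 \is a fin_num.
  by rewrite ge0_fin_numE //; apply: le_lt_trans (dist_le _ _ S1x1 S2x2) (ltry _).
have [dist_eq0|dist_neq0] := eqVneq (set_dist S1 S2) 0%E.
  by rewrite dist_eq0 mule0 mul0e leb_outer_ge0.
set d := fine (set_dist S1 S2).
have d0 : 0 < d by rewrite fine_gt0 // lt0e dist_neq0 dist0 ltey_eq finD.
have far x y : S1 x -> S2 y -> d <= enorm (x - y).
  by move=> S1x S2y; rewrite -lee_fin fineK // dist_le.
have far' x y : S2 x -> S1 y -> d <= enorm (x - y).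
  by move=> S2x S1y; rewrite -enormN opprB far.
have near x y : S x -> S y -> enorm (x - y) <= diam S.
  exact: compact_enorm_le_diam.
have dD : d <= diam S.
  by apply: le_trans (far _ _ S1x1 S2x2) _; apply: near; [exact: S1S | exact: S2S].
have D0 := lt_le_trans d0 dD.
have KS := @kernel_sub R n S.
have star x y : S x -> Defs.kernel S y -> segment x y `<=` S.
  by move=> Sx [_ /(_ x Sx)]; apply: subset_trans; exact: segmentC.
have KS1 : Defs.kernel S `&` S1 `<=` S by move=> x [/KS].
have KS2 : Defs.kernel S `&` S2 `<=` S by move=> x [/KS].
have cov12 : S `<=` S1 `|` S2 `|` S3.
  by rewrite -SE => x [[]|]; [left; left | right | left; right].
have cov21 : S `<=` S2 `|` S1 `|` S3 by rewrite (setUC S2).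
(* Segments from any point of [S1] to a kernel point in [S2] stay in [S]; [b2] exchanges the roles
   of [S1] and [S2]. *)
have b1 := separation_bound S S1 S2 S3 S1 (Defs.kernel S `&` S2) d (diam S) n0 cS cov12
  (fin _ S3S) (fun x h => h) (@subIsetr _ _ _) S1S KS2
  (fun x y S1x Ky => star x y (S1S x S1x) Ky.1) d0 far D0
  (fun x y S1x Ky => near x y (S1S x S1x) (KS2 y Ky)) (fin _ S1S) (fin _ KS2).
have b2 := separation_bound S S2 S1 S3 S2 (Defs.kernel S `&` S1) d (diam S) n0 cS cov21
  (fin _ S3S) (fun x h => h) (@subIsetr _ _ _) S2S KS1
  (fun x y S2x Ky => star x y (S2S x S2x) Ky.1) d0 far' D0
  (fun x y S2x Ky => near x y (S2S x S2x) (KS1 y Ky)) (fin _ S2S) (fin _ KS1).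
have fine_mono T T' : T `<=` T' -> T' `<=` S -> fine (leb_outer T) <= fine (leb_outer T').
  move=> TT' T'S; apply: fine_le; [exact/fin/(subset_trans TT') | exact: fin |].
  exact: le_leb_outer.
have fine_leb_ge0 T : 0 <= fine (@leb_outer R n T) by rewrite fine_ge0 // leb_outer_ge0.
(* Division by 0 yields 0, so a positive ratio excludes a zero volume. *)
have s0 : 0 < fine (leb_outer S).
  rewrite lt0r fine_leb_ge0 andbT; apply/eqP => s_eq0.
  by move: eta0; rewrite /star_ratio /vol s_eq0 invr0 mulr0 ltxx.
have split3 : fine (leb_outer (Defs.kernel S)) <= fine (leb_outer (Defs.kernel S `&` S1)) +
    (fine (leb_outer (Defs.kernel S `&` S2)) + fine (leb_outer S3)).
  rewrite -lee_fin !EFinD !fineK ?fin //; apply: leb_outer_split3 => //.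
  by rewrite SE.
rewrite -(fineK (fin _ S1S)) -(fineK (fin _ S2S)) -(fineK (fin _ S3S)).
rewrite -(fineK finD) -EFin_min -!EFinM lee_fin /star_ratio /vol.
by apply: ratio_bound b1 b2 => //; exact: fine_mono.
Qed.
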